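(* Let $\mathbb{K}$ be an algebraically closed field, let $n\geq 2$ and $r\geq 1$ be integers, let $(d_1,\dots,d_n)\in\mathbb{Z}_{\ge 0}^n$ and $(m_1,\dots,m_r)\in\mathbb{Z}_{\ge 0}^r$, and let $\mathcal{L}=\mathcal{L}_{(d_1,\dots,d_n)}(m_1,\dots,m_r)$ be the linear system of hypersurfaces of multidegree $(d_1,\dots,d_n)$ in $(\mathbb{P}^1)^n$ having multiplicity at least $m_j$ at $q_j$ for $1\le j\le r$, where $q_1,\dots,q_r\in(\mathbb{P}^1)^n$ are points in very general position. Then $$\dim(\mathcal{L})\ \geq\ \operatorname{efdim}(\mathcal{L})\ \geq\ \operatorname{edim}(\mathcal{L}).$$
   Context: Let $V(\mathcal{L})$ be the $\mathbb{K}$-vector space of multihomogeneous polynomials in $\mathbb{K}[x_1,y_1,\dots,x_n,y_n]$ of multidegree $(d_1,\dots,d_n)$ (degree $d_i$ in the pair $x_i,y_i$) with multiplicity at least $m_j$ at $q_j$ for every $j$ (no condition if $m_j=0$). Set $\dim(\mathcal{L})=\dim_{\mathbb{K}}V(\mathcal{L})-1$ (so the empty system has dimension $-1$). Distinct points $q_1,\dots,q_r\in(\mathbb{P}^1)^n$ are in very general position if, for every $d\in\mathbb{Z}_{\ge0}^n$ and $m\in\mathbb{Z}_{\ge0}^r$, the dimension of the space of multihomogeneous polynomials of multidegree $d$ with multiplicity at least $m_j$ at $q_j$ for all $j$ attains the minimal value among all $r$-tuples of distinct points of $(\mathbb{P}^1)^n$. Virtual and expected dimension: $$\operatorname{vdim}(\mathcal{L})=\prod_{i=1}^n(d_i+1)-\sum_{j=1}^r\binom{n+m_j-1}{n}-1,\qquad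 \operatorname{edim}(\mathcal{L})=\max(\operatorname{vdim}(\mathcal{L}),-1).$$ For $I\subseteq\{1,\dots,n\}$ put $s_I=\sum_{i\in I}d_i$ and $S_I=1+|I|+s_I$ (so $s_\emptyset=0$, $S_\emptyset=1$). Fiber dimension and fiber-expected dimension: $$\operatorname{fdim}(\mathcal{L})=\prod_{i=1}^n(d_i+1)-\sum_{\substack{1\le j\le r,\ I\subseteq\{1,\dots,n\}\\ S_I\le m_j}}(-1)^{|I|}\binom{m_j-S_I+n}{n}-1,\qquad \operatorname{efdim}(\mathcal{L})=\max(-1,\operatorname{fdim}(\mathcal{L})).$$ *)

(* Defs.v *)
From HB Require Import structures.
From mathcomp Require Import all_boot all_order all_algebra.
From mathcomp Require Import mpoly.

Set Implicit Arguments.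
Unset Strict Implicit.
Unset Printing Implicit Defensive.

Import GRing.Theory Num.Theory.
Local Open Scope quotient_scope.
Local Open Scope ring_scope.

Section ProjectiveLine.
Variable K : fieldType.

Definition homcoord := {v : K * K | v != 0}.

Definition proportional : rel homcoord :=
  fun u v => (val u).1 * (val v).2 == (val v).1 * (val u).2.

Lemma proportional_refl : reflexive proportional.
Proof. by move=> u; rewrite /proportional. Qed.

Lemma proportional_sym : ssrbool.symmetric proportional.
Proof. by move=> u v; rewrite /proportional eq_sym. Qed.

Lemma proportional_trans : transitive proportional.
Proof.
case=> [[c d] /= hv] [[a b] /= hu] [[e f] /= hw].
rewrite /proportional /= => /eqP h1 /eqP h2.
have [d0 | dn0] := eqVneq d 0.
  have cn0 : c != 0 by apply: contraNneq hv => c0; rewrite c0 d0.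
  move: h1 h2; rewrite d0 !mulr0 => /esym/eqP; rewrite mulf_eq0 (negPf cn0) /=.
  move=> /eqP -> /eqP; rewrite mulf_eq0 (negPf cn0) /= => /eqP ->.
  by rewrite !mulr0.
apply/eqP/(mulfI dn0); rewrite mulrCA mulrA h1 mulrAC h2.
by rewrite -mulrA mulrCA.
Qed.

Canonical proportional_equiv :=
  EquivRel proportional
    proportional_refl proportional_sym proportional_trans.

Definition P1 := {eq_quot proportional_equiv}.
HB.instance Definition _ := Choice.on P1.
HB.instance Definition _ := EqQuotient.on P1.

Definition homcoord_of (p : P1) : K * K := val (repr p).

End ProjectiveLine.

Definition P1n (K : fieldType) (n : nat) := {ffun 'I_n -> P1 K}.

Section Multihomogeneous.
Variables (K : fieldType) (n : nat).

(* The variable x_i of K[x_1,y_1,...,x_n,y_n] is 'X_(lshift n i) and y_i is   *)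
(* 'X_(rshift n i).                                                           *)
Definition multihomog_pred (d : 'I_n -> nat) : pred {mpoly K[n + n]} :=
  fun p => all (fun a : 'X_{1..n + n} =>
    [forall i, a (lshift n i) + a (rshift n i) == d i]%N) (msupp p).
Arguments multihomog_pred _ _ /.

Definition multihomog (d : 'I_n -> nat) : qualifier 0 {mpoly K[n + n]} :=
  [qualify p | multihomog_pred d p].

Lemma multihomogP (d : 'I_n -> nat) (p : {mpoly K[n + n]}) :
  reflect (forall a, a \in msupp p ->
             forall i, (a (lshift n i) + a (rshift n i))%N = d i)
          (p \is multihomog d).
Proof.
apply: (iffP allP) => h a ha; last by apply/forallP => i; rewrite h.
by move=> i; have /forallP/(_ i)/eqP := h a ha.
Qed.

Lemma multihomog_submod_closed (d : 'I_n -> nat) :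
  submod_closed (multihomog d).
Proof.
split=> [|c p q hp hq]; first by apply/multihomogP => a; rewrite msupp0.
apply/multihomogP => a /msuppD_le; rewrite mem_cat => /orP [/msuppZ_le|].
  exact/multihomogP.
exact/multihomogP.
Qed.

HB.instance Definition _ d :=
  GRing.isSubmodClosed.Build K {mpoly K[n + n]} (multihomog_pred d)
    (multihomog_submod_closed d).

Record mhpoly (d : 'I_n -> nat) := MHPoly {
  mpoly_of_mhpoly :> {mpoly K[n + n]};
  _ : mpoly_of_mhpoly \is multihomog d
}.

HB.instance Definition _ d := [isSub for @mpoly_of_mhpoly d].
HB.instance Definition _ d := [Choice of mhpoly d by <:].
HB.instance Definition _ d := [SubChoice_isSubLmodule of mhpoly d by <:].

Section FiniteDimension.
Variable d : 'I_n -> nat.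

Definition mhindex := {dffun forall i : 'I_n, 'I_(d i).+1}.

Definition mhmonom (e : mhindex) : 'X_{1..n + n} :=
  [multinom match split k with inl i => (e i : nat) | inr i => (d i - e i)%N end
    | k < n + n].

Lemma mhmonom_l e i : mhmonom e (lshift n i) = e i.
Proof. by rewrite mnmE -[lshift n i]/(unsplit (inl i)) unsplitK. Qed.

Lemma mhmonom_r e i : mhmonom e (rshift n i) = (d i - e i)%N.
Proof. by rewrite mnmE -[rshift n i]/(unsplit (inr i)) unsplitK. Qed.

Lemma mhmonom_inj : injective mhmonom.
Proof.
move=> e f h; apply/ffunP => i; apply/val_inj.
by rewrite /= -!mhmonom_l h.
Qed.

Lemma mhmonom_surj (a : 'X_{1..n + n}) :
  (forall i, a (lshift n i) + a (rshift n i) = d i)%N ->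
  exists e, mhmonom e = a.
Proof.
move=> h; have lt i : (a (lshift n i) < (d i).+1)%N by rewrite ltnS -h leq_addr.
exists [ffun i => Ordinal (lt i)]; apply/mnmP => k.
rewrite -(splitK k); case: (split k) => i /=.
  by rewrite mhmonom_l ffunE.
by rewrite mhmonom_r ffunE /= -h addKn.
Qed.

Definition mhcoord (p : mhpoly d) : 'rV[K]_#|{: mhindex}| :=
  \row_k (val p)@_(mhmonom (enum_val k)).

Lemma mhpoly_vecaxiom : Vector.axiom #|{: mhindex}| (mhpoly d).
Proof.
exists mhcoord; first by move=> c p q; apply/rowP => k; rewrite !mxE linearP.
pose g (v : 'rV[K]_#|{: mhindex}|) : {mpoly K[n + n]} :=
  \sum_k v 0 k *: 'X_[mhmonom (enum_val k)].
have gE v k : (g v)@_(mhmonom (enum_val k)) = v 0 k.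
  rewrite /g raddf_sum /= (bigD1 k) //= mcoeffZ mcoeffX eqxx mulr1.
  rewrite big1 ?addr0 // => j jk; rewrite mcoeffZ mcoeffX.
  by rewrite (inj_eq mhmonom_inj) (inj_eq enum_val_inj) (negPf jk) mulr0.
have gh v : g v \is multihomog d.
  rewrite /g rpred_sum // => k _; rewrite rpredZ //.
  apply/multihomogP => a; rewrite msuppX inE => /eqP -> i.
  by rewrite mhmonom_l mhmonom_r subnKC // -ltnS.
exists (fun v => MHPoly (gh v)) => [p | v]; last first.
  by apply/rowP => k; rewrite mxE /= gE.
apply/val_inj/mpolyP => a /=.
case ha: [forall i, a (lshift n i) + a (rshift n i) == d i]%N.
  have [|e <-] := mhmonom_surj (a := a).
    by move=> i; apply/eqP; move/forallP: ha.
  by rewrite -(enum_rankK e) gE mxE.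
rewrite !memN_msupp_eq0 //; apply/negP => h; move/negP: ha; case.
  by apply/forallP => i; apply/eqP/(multihomogP _ _ (valP p)).
by apply/forallP => i; apply/eqP/(multihomogP _ _ (gh (mhcoord p))).
Qed.

HB.instance Definition _ :=
  Lmodule_hasFinDim.Build K (mhpoly d) mhpoly_vecaxiom.

End FiniteDimension.

(* Local coordinates t_1,...,t_n of (P^1)^n centred at q.  In the i-th factor *)
(* q_i = [a : b] lies in the chart y_i = 1 if b != 0, where x_i = a/b + t_i;  *)
(* otherwise q_i = [1 : 0] lies in the chart x_i = 1, where y_i = t_i.        *)
Definition local_coord (q : P1n K n) (k : 'I_(n + n)) : {mpoly K[n]} :=
  match split k with
  | inl i => let: (a, b) := homcoord_of (q i) in
             if b != 0 then (a / b)%:MP + 'X_i else 1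
  | inr i => let: (a, b) := homcoord_of (q i) in
             if b != 0 then 1 else 'X_i
  end.

Definition local_eqn (q : P1n K n) (f : {mpoly K[n + n]}) : {mpoly K[n]} :=
  f \mPo [tuple local_coord q k | k < n + n].

(* f has multiplicity at least m at q: its local equation lies in the m-th    *)
(* power of the maximal ideal (t_1,...,t_n).                                  *)
Definition mult_ge (m : nat) (q : P1n K n) (f : {mpoly K[n + n]}) : Prop :=
  forall a : 'X_{1..n}, (mdeg a < m)%N -> (local_eqn q f)@_a = 0.

Section LinearSystem.
Variable d : 'I_n -> nat.

Definition jet (m : nat) (q : P1n K n) (f : mhpoly d) :
    {ffun 'X_{1..n < m} -> K^o} :=
  [ffun a : 'X_{1..n < m} => (local_eqn q f)@_a].

Lemma jet_is_linear m q : linear (@jet m q).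
Proof.
move=> c f g; apply/ffunP => a; rewrite !ffunE /local_eqn.
by rewrite linearP linearP.
Qed.

HB.instance Definition _ m q :=
  GRing.isLinear.Build K (mhpoly d) {ffun 'X_{1..n < m} -> K^o} _ (@jet m q)
    (@jet_is_linear m q).

(* The space V(L); lemma [mem_linsys] below is its defining property. *)
Definition linsys (r : nat) (m : 'I_r -> nat) (q : 'I_r -> P1n K n) :
    {vspace mhpoly d} :=
  (\bigcap_(j < r) lker (linfun (@jet (m j) (q j))))%VS.

Lemma mem_linsys r (m : 'I_r -> nat) (q : 'I_r -> P1n K n) (f : mhpoly d) :
  f \in linsys m q <-> forall j, mult_ge (m j) (q j) f.
Proof.
have -> : (f \in linsys m q)
    = [forall j, f \in lker (linfun (@jet (m j) (q j)))].
  rewrite memvE; apply/subv_bigcapP/forallP => [h j | h j _].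
    by rewrite memvE h.
  by rewrite -memvE.
split=> [/forallP h j a ha | h].
  have := h j; rewrite memv_ker lfunE /= => /eqP /ffunP /(_ (BMultinom ha)).
  by rewrite !ffunE.
apply/forallP => j; rewrite memv_ker lfunE /=; apply/eqP/ffunP => a.
by rewrite !ffunE h // bmdeg.
Qed.

End LinearSystem.

End Multihomogeneous.

Arguments linsys {K n} d {r} m q.

Definition very_general (K : fieldType) (n r : nat) (q : 'I_r -> P1n K n) :=
  injective q /\
  forall (d : 'I_n -> nat) (m : 'I_r -> nat) (q' : 'I_r -> P1n K n),
    injective q' -> (\dim (linsys d m q) <= \dim (linsys d m q'))%N.

Definition dimL (K : fieldType) (n r : nat) (d : 'I_n -> nat)
    (m : 'I_r -> nat) (q : 'I_r -> P1n K n) : int :=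
  (\dim (linsys d m q))%:Z - 1.

Section ExpectedDimensions.
Variables (n r : nat) (d : 'I_n -> nat) (m : 'I_r -> nat).

(* The truncated subtraction in n + m_j - 1 is harmless as soon as 0 < n. *)
Definition vdim : int :=
  (\prod_(i < n) (d i + 1))%N%:Z
  - (\sum_(j < r) 'C(n + m j - 1, n))%N%:Z - 1.

Definition edim : int := Num.max vdim (-1).

Definition bigS (I : {set 'I_n}) : nat := (1 + #|I| + \sum_(i in I) d i)%N.

Definition fdim : int :=
  (\prod_(i < n) (d i + 1))%N%:Z
  - \sum_(j < r) \sum_(I : {set 'I_n} | (bigS I <= m j)%N)
      (-1) ^+ #|I| * ('C(m j - bigS I + n, n))%:Z
  - 1.

Definition efdim : int := Num.max (-1) fdim.

End ExpectedDimensions.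

(* Main.v *)
Require Import Defs.
From mathcomp Require Import all_boot all_order all_algebra.
From mathcomp Require Import mpoly.

Set Implicit Arguments.
Unset Strict Implicit.
Unset Printing Implicit Defensive.

Import Order.TTheory GRing.Theory Num.Theory.

Local Open Scope ring_scope.

(** In the local coordinates t_1, ..., t_n at a point of (P^1)^n, each pair
    x_i, y_i becomes either a/b + t_i, 1 or 1, t_i.  A form of multidegree d
    thus becomes a polynomial of degree at most d_i in each t_i, whichever
    chart contains the point ([deg_le_local_eqn]).  Its coefficients outside
    the box a_i <= d_i vanish from the start, so multiplicity m imposes at most
    N(d, m) conditions, the number of monomials t^a with |a| < m and
    a_i <= d_i for all i ([dim_limg_jet]).  Hence dim V(L) is at least
    prod (d_i + 1) - sum_j N(d, m_j) ([dim_linsys_ge]).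

    The fiber dimension is exactly this bound, because N(d, m) is its
    alternating sum ([card_box]).  Indeed, apply inclusion-exclusion to the
    conditions a_i > d_i: the monomials of degree < m with a_i > d_i for i in I
    are the multiples of the product of the t_i^(d_i + 1) over I, whose degree
    is S_I - 1, and there are C(m - S_I + n, n) of them when S_I <= m
    ([card_bmultinom_gt]).

    The second inequality holds because the box only removes monomials:
    N(d, m) is at most the number C(n + m - 1, n) of all monomials of degree
    less than m ([card_box_le]). *)

(** * Dimension counts in linear algebra *)

Section LinearAlgebra.
Variable K : fieldType.

(** Intersecting with the kernel of f_j lowers the dimension by the dimension
    of the image of the current subspace, which lies in the image of f_j. *)
Lemma dim_bigcap_lker (I : Type) (aT : vectType K) (rT : I -> vectType K)
    (f : forall j, 'Hom(aT, rT j)) (s : seq I) :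
  (\dim {:aT} <= \dim (\bigcap_(j <- s) lker (f j))
                 + \sum_(j <- s) \dim (limg (f j)))%N.
Proof.
elim: s => [|j s IHs]; first by rewrite !big_nil addn0.
rewrite !big_cons; apply: leq_trans IHs _.
rewrite addnA leq_add2r capvC.
by rewrite -[leqLHS](limg_ker_dim (f j)) leq_add2l dimvS ?limgS ?subvf.
Qed.

(** Such a subspace is spanned by the indicator functions of the points
    of A. *)
Lemma dim_ffun_supported (T : finType) (U : {vspace {ffun T -> K^o}})
    (A : {set T}) :
  (forall f, f \in U -> forall x, x \notin A -> f x = 0) -> (\dim U <= #|A|)%N.
Proof.
move=> UA; pose delta (x : T) : {ffun T -> K^o} := [ffun y => (y == x)%:R].
suff /dimvS/leq_trans : (U <= <<[seq delta x | x <- enum A]>>)%VS.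
  by apply; rewrite (leq_trans (dim_span _)) // size_map -cardE.
apply/subvP => f fU.
have -> : f = \sum_(x in A) (f x : K) *: delta x.
  apply/ffunP => y; rewrite sum_ffunE.
  have E x : ((f x : K) *: delta x) y = f x * (y == x)%:R :> K.
    by rewrite !ffunE.
  rewrite (eq_bigr _ (fun x _ => E x)).
  have [yA | yA] := boolP (y \in A).
    rewrite (bigD1 y) //= eqxx mulr1 big1 ?addr0 // => x /andP[_ xy].
    by rewrite eq_sym (negPf xy) mulr0.
  rewrite big1 ?(UA _ fU) // => x xA; rewrite (_ : y == x = false) ?mulr0 //.
  by apply: contraNF yA => /eqP ->.
apply: memv_suml => x xA; apply/memvZ/memv_span/map_f.
by rewrite mem_enum.
Qed.

End LinearAlgebra.

(** * Degree of local equations in each coordinate *)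

Section LocalDegree.
Variables (K : fieldType) (n : nat).

(** A relation rather than a degree function: the zero polynomial satisfies
    every bound, so sums need no case distinction. *)
Definition deg_le (i : 'I_n) (k : nat) (p : {mpoly K[n]}) :=
  forall a, a \in msupp p -> (a i <= k)%N.

Lemma deg_leW i k l p : (k <= l)%N -> deg_le i k p -> deg_le i l p.
Proof. by move=> kl pk a /pk /leq_trans; apply. Qed.

Lemma deg_leC i c : deg_le i 0 c%:MP.
Proof.
move=> a; rewrite msuppC; case: eqP; rewrite // inE => _ /eqP ->.
by rewrite mnm0E.
Qed.

Lemma deg_leX i j : deg_le i (j == i) 'X_j.
Proof. by move=> a; rewrite msuppX inE => /eqP ->; rewrite mnm1E. Qed.

Lemma deg_leD i k p q : deg_le i k p -> deg_le i k q -> deg_le i k (p + q).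
Proof. by move=> pk qk a /msuppD_le; rewrite mem_cat => /orP[/pk | /qk]. Qed.

Lemma deg_leM i k l p q :
  deg_le i k p -> deg_le i l q -> deg_le i (k + l) (p * q).
Proof.
move=> pk ql a /msuppM_le /allpairsP [[b c] /= [/pk bk /ql cl ->]].
by rewrite mnmDE leq_add.
Qed.

Lemma deg_leXn i k e p : deg_le i k p -> deg_le i (e * k) (p ^+ e).
Proof.
move=> pk; elim: e => [|e IHe]; first exact: deg_leC.
by rewrite exprS mulSn; apply: deg_leM.
Qed.

Lemma deg_le_prod i (I : Type) (s : seq I) (k : I -> nat)
    (p : I -> {mpoly K[n]}) :
  (forall j, deg_le i (k j) (p j)) ->
  deg_le i (\sum_(j <- s) k j) (\prod_(j <- s) p j).
Proof.
move=> pk; elim: s => [|j s IHs]; first by rewrite !big_nil; exact: deg_leC.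
by rewrite !big_cons; apply: deg_leM.
Qed.

Lemma deg_le_sum i k (I : eqType) (s : seq I) (p : I -> {mpoly K[n]}) :
  (forall j, j \in s -> deg_le i k (p j)) -> deg_le i k (\sum_(j <- s) p j).
Proof.
move=> pk; rewrite big_seq; apply: big_ind => //; last exact: deg_leD.
by move=> a; rewrite msupp0.
Qed.

(** In either chart one coordinate of the j-th pair is affine linear in t_j and
    the other is constant, so this common bound avoids tracking the chart. *)
Lemma deg_le_local_coord (q : P1n K n) i k :
  deg_le i (match split k with inl j => j == i | inr j => j == i end)
    (local_coord q k).
Proof.
have C c j : deg_le i (j == i) (c%:MP : {mpoly K[n]}).
  exact: deg_leW (leq0n _) (@deg_leC i c).
rewrite /local_coord; case: (split k) => j; case: (homcoord_of (q j)) => a b;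
  case: (b != 0); rewrite -?mpolyC1; by [exact: C | exact: deg_leX
  | apply: deg_leD; [exact: C | exact: deg_leX]].
Qed.

(** Both x_i and y_i have t_i-degree at most 1 and the other variables do not
    involve t_i: a monomial keeps at most its degree in the pair x_i, y_i. *)
Lemma deg_le_local_eqn (d : 'I_n -> nat) (q : P1n K n) (f : mhpoly K d) i :
  deg_le i (d i) (local_eqn q f).
Proof.
rewrite /local_eqn comp_mpolyEX; apply: deg_le_sum => a af.
rewrite -mul_mpolyC -[d i]add0n; apply: deg_leM; first exact: deg_leC.
rewrite comp_mpolyX -(multihomogP _ _ (valP f) a af i).
have := @deg_le_prod i _ (index_enum 'I_(n + n)) _ _
  (fun k => @deg_leXn i _ (a k) _ (@deg_le_local_coord q i k)).
rewrite big_split_ord /=.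
(* Only the exponents of x_i and y_i survive in the bound on the t_i-degree. *)
have splitl j : split (lshift n j) = inl j := unsplitK (inl j).
have splitr j : split (rshift n j) = inr j := unsplitK (inr j).
rewrite (bigD1 i) //= big1 => [|j /negPf ji]; last by rewrite splitl ji muln0.
rewrite (bigD1 i) //= big1 => [|j /negPf ji]; last by rewrite splitr ji muln0.
rewrite splitl splitr eqxx !muln1 !addn0.
by under [X in _ -> deg_le _ _ X]eq_bigr do rewrite tnth_mktuple.
Qed.

End LocalDegree.

(** * Counting the monomials of a truncated box *)

Section BoxCount.
Variable n : nat.

Definition box (d : 'I_n -> nat) (m : nat) : {set 'X_{1..n < m}} :=
  [set a : 'X_{1..n < m} | [forall i, (a i <= d i)%N]].

(** A monomial of degree at most m in n variables is a tuple of n exponents in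
    0..m with sum at most m. *)
Lemma card_bmultinom m : #|{: 'X_{1..n < m.+1}}| = 'C(m + n, n).
Proof.
rewrite addnC -card_partial_ord_partitions.
pose F (a : 'X_{1..n < m.+1}) : n.-tuple 'I_m.+1 := [tuple inord (a i) | i < n].
have FE a i : tnth (F a) i = a i :> nat.
  rewrite tnth_mktuple inordK // ltnS (leq_trans _ (bmdeg a : (_ <= m)%N)) //.
  by rewrite mdegE (bigD1 i) //= leq_addr.
have Fsum a : (\sum_(x <- F a) x = mdeg a)%N.
  by rewrite big_tuple mdegE; apply: eq_bigr => i _; rewrite FE.
have Finj : injective F.
  by move=> a b ab; apply/val_inj/mnmP => i; rewrite -!FE ab.
rewrite -(card_imset _ Finj); apply: eq_card => t; rewrite inE.
apply/imsetP/idP => [[a _ ->]|tm]; first by rewrite Fsum -ltnS bmdeg.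
have bm : (mdeg [multinom (tnth t i : nat) | i < n] < m.+1)%N.
  rewrite big_tuple in tm; rewrite mdegE ltnS.
  by under eq_bigr do rewrite mnmE.
exists (BMultinom bm) => //; apply: eq_from_tnth => i; apply: ord_inj.
by rewrite FE mnmE.
Qed.

(** Division by u, the product of the t_i^(d_i + 1) over I, is a bijection
    onto the monomials of degree at most m - S_I, since u has degree
    S_I - 1; if S_I > m, then u and its multiples have degree at least m. *)
Lemma card_bmultinom_gt (d : 'I_n -> nat) m (I : {set 'I_n}) :
  #|[set a : 'X_{1..n < m} | [forall i in I, (d i < a i)%N]]| =
  if (bigS d I <= m)%N then 'C(m - bigS d I + n, n) else 0%N.
Proof.
pose u : 'X_{1..n} := [multinom if i \in I then (d i).+1 else 0%N | i < n].
have uS : bigS d I = (mdeg u).+1.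
  rewrite /bigS -addnA add1n mdegE; congr S.
  rewrite (eq_bigr _ (fun i _ => mnmE _ i)) -big_mkcond /= addnC.
  by rewrite (eq_bigr _ (fun i _ => esym (addn1 (d i)))) big_split /= sum1_card.
have uP (a : 'X_{1..n}) : [forall i in I, (d i < a i)%N] = (u <= a)%MM.
  by apply: eq_forallb => i; rewrite mnmE; case: (i \in I).
rewrite uS; case: ifP => [um | /negP um]; last first.
  apply/eqP; rewrite cards_eq0; apply/eqP/setP => a; rewrite !inE uP.
  apply/negP => /submK ua; apply: um; apply: leq_trans (bmdeg a).
  by rewrite ltnS -ua mdegD leq_addl.
rewrite -card_bmultinom.
have bD (b : 'X_{1..n < (m - (mdeg u).+1).+1}) : (mdeg (u + b)%MM < m)%N.
  rewrite mdegD -ltn_subRL; apply: leq_trans (bmdeg b) _.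
  by rewrite subnSK.
pose F b := BMultinom (bD b).
have Finj : injective F.
  by move=> b c /(congr1 val) /= /mnmP bc; apply/val_inj/mnmP => i;
     have := bc i; rewrite !mnmDE => /addnI.
rewrite -(card_imset _ Finj); apply: eq_card => a; rewrite inE uP.
apply/idP/imsetP => [ua | [b _ ->]]; last exact: lem_addr.
have bm : (mdeg (a - u)%MM < (m - (mdeg u).+1).+1)%N.
  rewrite subnSK // ltn_subRL addnC -mdegD submK //; exact: bmdeg.
by exists (BMultinom bm) => //; apply: val_inj; rewrite /= addmC submK.
Qed.

(** Inclusion-exclusion over the sets I of indices i where a_i > d_i. *)
Lemma card_box (d : 'I_n -> nat) m :
  (#|box d m|%:Z = \sum_(I : {set 'I_n} | (bigS d I <= m)%N)
      (-1) ^+ #|I| * ('C(m - bigS d I + n, n))%:Z)%R.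
Proof.
have boxE (a : 'X_{1..n < m}) : ((a \in box d m)%:R : int) =
    \sum_(I : {set 'I_n}) (-1) ^+ #|I| * [forall i in I, (d i < a i)%N]%:R.
  (* The indicator of the box is the product of the 1 - [d_i < a_i]. *)
  transitivity (\prod_(i < n) (- (d i < a i)%N%:R + 1 : int)).
    rewrite inE; case: (boolP [forall i, (a i <= d i)%N]);
      [move=> /forallP ale | move=> /forallPn [i ai]].
      by rewrite big1 // => i _; rewrite ltnNge ale oppr0 add0r.
    by rewrite (bigD1 i) //= ltnNge ai addNr mul0r.
  rewrite bigA_distr; apply: eq_bigr => I _; rewrite -big_mkcond /= prodrN.
  congr (_ * _); case: (boolP [forall i in I, (d i < a i)%N]).
    move=> /forall_inP aI.
    by rewrite big1 // => i iI; rewrite aI.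
  rewrite negb_forall_in => /exists_inP [i iI ai].
  by rewrite (bigD1 i) //= (negPf ai) mul0r.
have cardE (T : finType) (A : {set T}) : #|A|%:Z = \sum_x (x \in A)%:R :> int.
  by rewrite -natz -sum1_card natr_sum big_mkcond; apply: eq_bigr => x _;
     case: (x \in A).
rewrite cardE (eq_bigr _ (fun a _ => boxE a)) exchange_big [RHS]big_mkcond /=.
apply: eq_bigr => I _; rewrite -mulr_sumr.
under eq_bigr => a _.
  rewrite (_ : [forall i in I, _] = (a \in [set a : 'X_{1..n < m} |
    [forall i in I, (d i < a i)%N]])); last by rewrite inE.
  over.
rewrite -cardE card_bmultinom_gt.
by case: ifP => _; rewrite ?mulr0.
Qed.

Lemma card_box_le (d : 'I_n -> nat) m : (#|box d m| <= 'C(n + m - 1, n))%N.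
Proof.
apply: leq_trans (max_card _) _.
case: m => [|m]; first by rewrite eq_card0 // => -[a].
by rewrite card_bmultinom addnS subn1 addnC.
Qed.

End BoxCount.

(** * The fiber dimension as a lower bound *)

Section LinearSystem.
Variables (K : fieldType) (n : nat) (d : 'I_n -> nat).

Lemma dim_mhpoly : \dim {:mhpoly K d} = (\prod_(i < n) (d i + 1))%N.
Proof.
rewrite dimvf /dim /= card_dep_ffun foldrE big_map big_enum /=.
by apply: eq_bigr => i _; rewrite card_ord addn1.
Qed.

(** Jets are supported on the box, by the bound on the t_i-degrees. *)
Lemma dim_limg_jet m (q : P1n K n) :
  (\dim (limg (linfun (jet (d := d) m q))) <= #|box d m|)%N.
Proof.
apply: dim_ffun_supported => _ /memv_imgP [f _ ->] a.
rewrite inE => /forallPn [i]; rewrite -ltnNge lfunE /= ffunE => di.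
apply: memN_msupp_eq0; apply: contraL di => af.
by rewrite -leqNgt; exact: (@deg_le_local_eqn K n d q f i a af).
Qed.

Lemma dim_linsys_ge r (m : 'I_r -> nat) (q : 'I_r -> P1n K n) :
  (\prod_(i < n) (d i + 1)
     <= \dim (linsys d m q) + \sum_(j < r) #|box d (m j)|)%N.
Proof.
rewrite -dim_mhpoly; have := dim_bigcap_lker
  (fun j => linfun (jet (d := d) (m j) (q j))) (index_enum 'I_r).
move/leq_trans; apply.
by rewrite leq_add2l; apply: leq_sum => j _; apply: dim_limg_jet.
Qed.

End LinearSystem.

Lemma fdim_box n r (d : 'I_n -> nat) (m : 'I_r -> nat) :
  fdim d m =
  (\prod_(i < n) (d i + 1))%N%:Z - (\sum_(j < r) #|box d (m j)|)%N%:Z - 1.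
Proof.
congr (_ - _ - _).
by rewrite -[RHS]natz natr_sum; apply: eq_bigr => j _; rewrite -card_box natz.
Qed.

Theorem theorem3p2 (K : closedFieldType) (n r : nat)
    (hn : (2 <= n)%N) (hr : (1 <= r)%N)
    (d : 'I_n -> nat) (m : 'I_r -> nat) (q : 'I_r -> P1n K n)
    (hq : very_general q) :
  dimL d m q >= efdim d m /\ efdim d m >= edim d m.
Proof.
rewrite /efdim /edim /dimL fdim_box /vdim; split.
  rewrite ge_max lerBrDr addNr lez_nat leq0n /= lerD2r lerBlDr -PoszD lez_nat.
  exact: dim_linsys_ge.
rewrite maxC le_max2 // lerD2r lerD2l lerN2 lez_nat.
by apply: leq_sum => j _; apply: card_box_le.
Qed.
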